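(* For every $p\in\{1,2,3,\ldots\}\cup\{\infty\}$ and every $n\in\mathbb{N}=\{1,2,3,\ldots\}$, there is a two-dimensional TSP instance with $16n$ vertices (points in $\mathbb{R}^2$) in which the distances are measured according to the $L_p$ metric and whose 2-Opt state graph contains a path of length $2^{n+4}-22$.
   Context: A TSP instance consists of a finite vertex set with a symmetric distance function; a tour is a Hamiltonian cycle. For points $x,y\in\mathbb{R}^d$, $\mathrm{dist}_p(x,y)=(\sum_{i}|x_i-y_i|^p)^{1/p}$ for $p\in\mathbb{N}$ and $\mathrm{dist}_\infty(x,y)=\max_i|x_i-y_i|$. A 2-change (2-Opt step) on a tour selects two tour edges $\{u_1,u_2\}$ and $\{v_1,v_2\}$ with $u_1,u_2,v_1,v_2$ distinct and appearing in this order along the tour, and replaces them by $\{u_1,v_1\}$ and $\{u_2,v_2\}$, provided this strictly decreases the tour length. The state graph has the tours as vertices and an arc from tour $v$ to tour $u$ if $u$ is obtained from $v$ by one such improving 2-change. *)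

(* Defs.v *)
From HB Require Import structures.
From mathcomp Require Import all_boot all_order all_algebra.
From mathcomp Require Import all_classical all_reals all_analysis.

Set Implicit Arguments.
Unset Strict Implicit.
Unset Printing Implicit Defensive.

Import Order.TTheory GRing.Theory Num.Theory.
Local Open Scope ring_scope.

(* The set {1, 2, 3, ...} together with infinity. *)
Variant lp_exponent := LpFin (p : nat) of (0 < p)%N | LpInfty.

Section LpDistance.
Variables (R : realType) (d : nat).
Implicit Types (p : lp_exponent) (x y : 'rV[R]_d).

Definition lp_dist p x y : R :=
  match p with
  | LpFin q _ => (\sum_(i < d) `|x ord0 i - y ord0 i| ^+ q) `^ (q%:R^-1)
  | LpInfty => \big[Num.max/0]_(i < d) `|x ord0 i - y ord0 i|
  end.

Lemma lp_distC p x y : lp_dist p x y = lp_dist p y x.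
Proof.
case: p => [q q_gt0|] /=; last by apply: eq_bigr => i _; rewrite distrC.
by congr (_ `^ _); apply: eq_bigr => i _; rewrite distrC.
Qed.

End LpDistance.

Record tsp_instance (R : realType) (N : nat) := TSPInstance {
  tsp_dist :> 'I_N -> 'I_N -> R;
  tsp_distC : forall u v, tsp_dist u v = tsp_dist v u }.

Definition lp_instance (R : realType) (d N : nat) (p : lp_exponent)
    (P : 'I_N -> 'rV[R]_d) : tsp_instance R N :=
  TSPInstance (fun u v => lp_distC p (P u) (P v)).

Definition cycle_edges (N : nat) (s : seq 'I_N) : {set {set 'I_N}} :=
  [set [set x; next s x] | x in s].

(* A repetition-free sequence of N vertices lists all of 'I_N. *)
Definition traverses (N : nat) (s : N.-tuple 'I_N) (E : {set {set 'I_N}}) :=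
  uniq s && (E == cycle_edges s).

(* Tours are undirected and unrooted: a tour is the edge set of a Hamiltonian
   cycle, so that cyclic sequences differing by a rotation or a reversal are
   the same vertex of the state graph. *)
Definition is_tour (N : nat) (E : {set {set 'I_N}}) :=
  (2 < N)%N && [exists s : N.-tuple 'I_N, traverses s E].

Record tour (N : nat) := Tour {
  tour_edges :> {set {set 'I_N}};
  tourP : is_tour tour_edges }.

HB.instance Definition _ N := [isSub for @tour_edges N].
HB.instance Definition _ N := [Finite of tour N by <:].

Section StateGraph.
Variables (R : realType) (N : nat).
Implicit Types (I : tsp_instance R N) (T : tour N).

(* Each undirected edge {u, v} is counted once, with u < v. *)
Definition tour_length I T : R :=
  \sum_(u < N) \sum_(v < N | (u < v)%N && ([set u; v] \in tour_edges T)) I u v.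

(* s is an arbitrary traversal of T (any starting point, any direction), so the
   subseq condition expresses the cyclic order along the tour. *)
Definition two_change T T' : Prop :=
  exists (s : N.-tuple 'I_N) (u1 u2 v1 v2 : 'I_N),
    [/\ traverses s T /\ uniq [:: u1; u2; v1; v2],
        [set u1; u2] \in tour_edges T,
        [set v1; v2] \in tour_edges T,
        subseq [:: u1; u2; v1; v2] s
      & tour_edges T' = (tour_edges T :\: [set [set u1; u2]; [set v1; v2]])
                          :|: [set [set u1; v1]; [set u2; v2]] ].

Definition state_graph I : rel (tour N) :=
  fun T T' => `[< two_change T T' /\ tour_length I T' < tour_length I T >].

(* The length of a path is its number of arcs. *)
Definition has_path_of_length I (L : nat) : Prop :=
  exists (T : tour N) (Ts : seq (tour N)),
    [/\ path (state_graph I) T Ts, uniq (T :: Ts) & size Ts = L].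

End StateGraph.

(* Main.v *)
(* The tours simulate a binary counter.  There are 2n gadgets of eight points,
   each one a copy of the previous one shrunk by 16 towards the origin.  Each
   has two blocks A, B, C, D, and a block is visited either along the long path
   A B C D or along the short path A C B D.  Seven improving 2-changes turn one
   long block of gadget i into a short one and at the same time make both short
   blocks of gadget i + 1 long again.  Hence shortening both blocks of gadget i
   triggers two complete runs of gadget i + 1, and the number of steps doubles
   with every gadget; in total there are 2^(2n + 3) - 14 steps.

   To treat all p at once, every gain is estimated between the maximum distance
   (for the removed edges) and the Euclidean distance (for the added edges),
   which sandwich the L_p distance for p >= 2.  The L_1 plane is isometric, up
   to a factor, to the maximum plane. *)

Require Import Defs.
From HB Require Import structures.
From mathcomp Require Import all_boot all_order all_algebra.
From mathcomp Require Import all_classical all_reals all_analysis.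
From mathcomp Require Import zify ring lra.

Set Implicit Arguments.
Unset Strict Implicit.
Unset Printing Implicit Defensive.

Import Order.TTheory GRing.Theory Num.Theory.
Local Open Scope ring_scope.

(** * Segment reversals on sequences *)

Lemma perm_flip (T : eqType) (s : seq T) u1 u2 b v1 v2 t :
  perm_eq (s ++ u1 :: u2 :: b ++ v1 :: v2 :: t)
          (s ++ u1 :: v1 :: rev b ++ u2 :: v2 :: t).
Proof.
rewrite perm_cat2l perm_cons -(cat_rcons v1) -(cat_rcons u2).
rewrite -!cat_cons perm_cat2r -rev_cons -rev_rcons rcons_cons.
by rewrite perm_sym perm_rev.
Qed.

Section FlipSequences.
Variables (R : realType) (T : eqType) (d : T -> T -> R).
Implicit Types s t : seq T.

(** A 2-change seen as the reversal of the segment from [u2] to [v1]. The edge closing the sequence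
    into a cycle is never removed in this form. *)
Variant improving_flip : seq T -> seq T -> Prop :=
  ImprovingFlip s u1 u2 b v1 v2 t of d u1 v1 + d u2 v2 < d u1 u2 + d v1 v2 :
    improving_flip (s ++ u1 :: u2 :: b ++ v1 :: v2 :: t)
                   (s ++ u1 :: v1 :: rev b ++ u2 :: v2 :: t).

Inductive flips : nat -> seq T -> seq T -> Prop :=
| Flips0 s : flips 0 s s
| FlipsS k s t r of improving_flip s t & flips k t r : flips k.+1 s r.

Lemma flips_trans k l s t r : flips k s t -> flips l t r -> flips (k + l) s r.
Proof. by elim=> // k' s' t' r' st _ IH /IH; apply: FlipsS. Qed.

Lemma improving_flip_perm s t : improving_flip s t -> perm_eq s t.
Proof. by case=> *; apply: perm_flip. Qed.

End FlipSequences.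

(** Carries runs on numeric labels over to vertices. Agreement of the distances on [s] is enough,
    since flips only permute its entries. *)
Lemma flips_map (R : realType) (T U : eqType) (d : T -> T -> R)
    (e : U -> U -> R) (f : T -> U) k s t :
    {in s &, forall x y, e (f x) (f y) = d x y} ->
  flips d k s t -> flips e k (map f s) (map f t).
Proof.
move=> + st; elim: st => [{}s|{}k {}s {}t r st _ IH] ed; first exact: Flips0.
apply: (@FlipsS _ _ _ _ _ (map f t)); last first.
  apply: IH => x y; rewrite -!(perm_mem (improving_flip_perm st)).
  exact: ed.
case: st ed => {s t IH} s u1 u2 b v1 v2 t lt_d ed.
rewrite !map_cat !map_cons !map_cat map_rev !map_cons.
apply: ImprovingFlip.
by rewrite !ed // !(mem_cat, inE) eqxx ?orbT.
Qed.

(** * Edge sets of cyclic sequences *)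

Section EdgeSets.
Variable N : nat.
Implicit Types (s t b : seq 'I_N) (x y z : 'I_N).

Definition path_edges x s : seq {set 'I_N} :=
  pairmap (fun y z => [set y; z]) x s.

Lemma path_edges_rev x s y :
  path_edges y (rev (x :: s)) =i [set y; last x s] :: path_edges x s.
Proof.
elim: s x y => [|z s IH] x y e; first by [].
rewrite rev_cons -cats1 /path_edges pairmap_cat mem_cat IH /= !inE.
by rewrite rev_cons last_rcons (finset.setUC [set z]) -orbA (orbC (e \in _)).
Qed.

Lemma path_edges_sub x s e y :
  e \in path_edges x s -> y \in e -> y \in x :: s.
Proof.
elim: s x => // z s IH x; rewrite /= inE => /orP [/eqP ->|/IH es /es ye].
  by rewrite !inE => /orP [] ->; rewrite ?orbT.
by rewrite inE ye orbT.
Qed.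

Lemma cycle_edges_rot k s : uniq s -> cycle_edges (rot k s) = cycle_edges s.
Proof.
move=> us; apply/setP => e; apply/imsetP/imsetP => -[x xs ->];
  by exists x; rewrite ?next_rot // ?mem_rot // -(mem_rot k).
Qed.

Lemma cycle_edgesE x s : uniq (x :: s) ->
  cycle_edges (x :: s) =i path_edges x (rcons s x).
Proof.
move=> us e; have sz : size (path_edges x (rcons s x)) = (size s).+1.
  by rewrite size_pairmap size_rcons.
have nextE i : (i <= size s)%N ->
    next (x :: s) (nth x (x :: s) i) = nth x (rcons s x) i.
  move=> le_i; rewrite next_nth mem_nth // index_uniq // nth_rcons.
  (* At the last index both sides are [x]: the successor wraps around to the head, which [rcons] has
     appended. *)
  by case: ltnP => // ge_i; rewrite nth_default // if_same.
have edgeE i : (i <= size s)%N ->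
    nth [set x] (path_edges x (rcons s x)) i =
    [set nth x (x :: s) i; next (x :: s) (nth x (x :: s) i)].
  move=> le_i; rewrite (nth_pairmap x) ?size_rcons // nextE //.
  congr [set _; _].
  by case: i le_i => //= i lt_i; rewrite nth_rcons lt_i.
apply/imsetP/idP => [[y ys ->]|/(nthP [set x]) [i]]; last first.
  rewrite sz => lt_i <-; exists (nth x (x :: s) i); first exact: mem_nth.
  exact: edgeE.
have lt_i : (index y (x :: s) < (size s).+1)%N by rewrite index_mem.
by rewrite -[y](nth_index x ys) -edgeE // mem_nth ?sz.
Qed.

(** Rotating the cycle to start at [u1] exposes the two edges to be removed and the two paths that
    survive the flip. *)
Lemma cycle_edges_cut s u1 u2 b v1 v2 t :
  let S := s ++ u1 :: u2 :: b ++ v1 :: v2 :: t in uniq S ->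
  cycle_edges S =i [:: [set u1; u2]; [set v1; v2]]
    ++ path_edges u2 (rcons b v1) ++ path_edges v2 (rcons (t ++ s) u1).
Proof.
move=> S uS e; rewrite -(cycle_edges_rot (size s)) // rot_size_cat.
rewrite cycle_edgesE; last first.
  by rewrite -[_ :: _]/((u1 :: u2 :: b ++ v1 :: v2 :: t) ++ s) uniq_catC.
rewrite -[_ :: _ ++ s]/(u2 :: (b ++ v1 :: v2 :: t) ++ s) -catA /= -cats1.
rewrite -!catA /= -cat_rcons /path_edges /= pairmap_cat last_rcons /=.
rewrite !(inE, mem_cat) -!cats1 -catA; congr orb; exact: orbCA.
Qed.

(** Both cycles share the two paths of the cut, one of them reversed. Each removed edge joins the
    vertex-disjoint sets [X] and [Y] of these paths, so it lies on neither path. *)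
Lemma cycle_edges_flip s u1 u2 b v1 v2 t :
  let S := s ++ u1 :: u2 :: b ++ v1 :: v2 :: t in uniq S ->
  cycle_edges (s ++ u1 :: v1 :: rev b ++ u2 :: v2 :: t) =
  (cycle_edges S :\: [set [set u1; u2]; [set v1; v2]])
    :|: [set [set u1; v1]; [set u2; v2]].
Proof.
move=> S uS; have := uS; rewrite (perm_uniq (perm_flip _ _ _ _ _ _ _)) => uS'.
pose X := u2 :: rcons b v1; pose Y := v2 :: rcons (t ++ s) u1.
have XY x : x \in X -> x \notin Y.
  have : uniq (X ++ Y).
    rewrite -[Y]/(rcons (v2 :: t ++ s) u1) -cats1 -[_ :: _ ++ _]cat_cons -catA.
    rewrite catA uniq_catC -catA /X cat_cons cat_rcons; exact: uS.
  rewrite cat_uniq => /and3P [_ /hasPn XY _] xX.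
  by apply/negP => /XY; rewrite /= xX.
have mid : path_edges v1 (rcons (rev b) u2) =i path_edges u2 (rcons b v1).
  move=> e; rewrite -rev_cons path_edges_rev /path_edges -cats1 pairmap_cat.
  by rewrite mem_cat /= !inE orbC (finset.setUC [set v1]).
apply/setP => e; rewrite !inE !cycle_edges_cut // !(mem_cat, inE) mid.
set P := path_edges u2 _; set Q := path_edges v2 _.
have: e \in P -> (e != [set u1; u2]) && (e != [set v1; v2]).
  move=> eP; rewrite -negb_or; apply/negP => /orP [] /eqP e_eq.
    have /XY : u1 \in X by apply: path_edges_sub eP _; rewrite e_eq !inE eqxx.
    by rewrite !(inE, mem_rcons) eqxx orbT.
  have /XY : v2 \in X.
    by apply: path_edges_sub eP _; rewrite e_eq !inE eqxx orbT.
  by rewrite !inE eqxx.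
have: e \in Q -> (e != [set u1; u2]) && (e != [set v1; v2]).
  move=> eQ; rewrite -negb_or; apply/negP => /orP [] /eqP e_eq.
    have /negP[] : u2 \notin Y by apply: XY; rewrite !inE eqxx.
    by apply: path_edges_sub eQ _; rewrite e_eq !inE eqxx orbT.
  have /negP[] : v1 \notin Y by apply: XY; rewrite !(inE, mem_rcons) eqxx orbT.
  by apply: path_edges_sub eQ _; rewrite e_eq !inE eqxx.
case: (e == [set u1; u2]); case: (e == [set v1; v2]);
  case: (e \in P); case: (e \in Q); rewrite //= ?orbT ?orbF //;
  do 2?[by move/(_ isT) | move=> _].
Qed.

Lemma is_tour_cycle_edges s :
  (2 < N)%N -> uniq s -> size s = N -> is_tour (cycle_edges s).
Proof.
move=> N2 us /eqP szs; rewrite /is_tour N2; apply/existsP.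
by exists (Tuple szs); rewrite /traverses us /=.
Qed.

End EdgeSets.

(** * Tour lengths and paths in the state graph *)

Section TourLength.
Variables (R : realType) (N : nat) (I : tsp_instance R N).
Hypothesis I_ge0 : forall u v, 0 <= I u v.
Implicit Types (s t : seq 'I_N) (T : tour N) (e : {set 'I_N}).

Definition edge_length e : R :=
  \sum_(p : 'I_N * 'I_N | (p.1 < p.2)%N && ([set p.1; p.2] == e)) I p.1 p.2.

Lemma edge_length_ge0 e : 0 <= edge_length e.
Proof. by apply: sumr_ge0. Qed.

Lemma edge_length_set2 u v : u != v -> edge_length [set u; v] = I u v.
Proof.
wlog lt_uv : u v / (u < v)%N => [hwlog neq_uv|_].
  case: (ltngtP u v) (neq_uv) => [lt_uv|lt_vu|/val_inj ->]; rewrite ?eqxx //.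
    exact: hwlog.
  by rewrite finset.setUC tsp_distC eq_sym => ?; apply: hwlog.
rewrite /edge_length (bigD1 (u, v)) /=; last by rewrite lt_uv eqxx.
rewrite big1 ?addr0 // => -[x y] /= /andP [/andP [lt_xy /eqP eq_xy]].
rewrite xpair_eqE => /negP[].
have := set21 u v; have := set22 u v; rewrite -eq_xy !inE.
case/orP=> /eqP ev /orP [] /eqP eu; move: lt_uv lt_xy; rewrite ev eu.
- by rewrite ltnn.
- by move=> lt1 lt2; have := ltn_trans lt1 lt2; rewrite ltnn.
- by rewrite !eqxx.
- by rewrite ltnn.
Qed.

Lemma tour_lengthE T : tour_length I T = \sum_(e in tour_edges T) edge_length e.
Proof.
rewrite /tour_length pair_big_dep /=.
rewrite (partition_big (fun p : 'I_N * 'I_N => [set p.1; p.2])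
  (mem (tour_edges T))) /=; last by move=> p /andP[].
apply: eq_bigr => e eT; apply: eq_bigl => p.
by case: eqP => [->|_]; rewrite ?eT ?andbT ?andbF.
Qed.

(** An inequality is enough for added edges; it avoids proving that they are new, at the price of
    nonnegative distances. *)
Lemma sum_edge_lengthU1 e (A : {set {set 'I_N}}) :
  \sum_(f in e |: A) edge_length f
    <= edge_length e + \sum_(f in A) edge_length f.
Proof.
have [eA|eNA] := boolP (e \in A); last by rewrite big_setU1.
have -> : e |: A = A by apply/finset.setUidPr; rewrite finset.sub1set.
by rewrite lerDr edge_length_ge0.
Qed.

Lemma improving_flip_state_graph s t T T' :
    uniq s -> size s = N -> tour_edges T = cycle_edges s ->
    tour_edges T' = cycle_edges t -> improving_flip I s t ->
  state_graph I T T'.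
Proof.
move=> us szs TE T'E st; case: st us szs TE T'E => {s t}.
move=> s u1 u2 b v1 v2 t lt_I us szs TE T'E; apply/asboolP.
have sub : subseq [:: u1; u2; v1; v2] (s ++ u1 :: u2 :: b ++ v1 :: v2 :: t).
  apply: subseq_trans (suffix_subseq _ _); rewrite /= !eqxx.
  by apply: subseq_trans (suffix_subseq _ _); rewrite /= !eqxx sub0seq.
have uuv := subseq_uniq sub us.
have cut := cycle_edges_cut us; have T'T := cycle_edges_flip us.
have e1 : [set u1; u2] \in tour_edges T by rewrite TE cut inE eqxx.
have e2 : [set v1; v2] \in tour_edges T by rewrite TE cut !inE eqxx orbT.
have := szs => /eqP szs'.
split.
  exists (Tuple szs'), u1, u2, v1, v2; split => //.
    by rewrite /traverses us TE /=.
  by rewrite T'E T'T TE.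
move: uuv; rewrite /= !inE !negb_or -!andbA.
case/and5P=> u12 u1v1 u1v2 u2v1 /and3P[u2v2 v12 _].
rewrite !tour_lengthE T'E T'T -TE finset.setUC -finset.setUA.
apply: le_lt_trans (sum_edge_lengthU1 _ _) _.
apply: le_lt_trans (lerD (lexx _) (sum_edge_lengthU1 _ _)) _.
have e12 : [set u1; u2] != [set v1; v2].
  apply/eqP => /setP /(_ u1); rewrite !inE eqxx /= (negPf u1v1).
  by rewrite (negPf u1v2).
rewrite (big_setD1 _ e1) (big_setD1 [set v1; v2]) /=; last first.
  by rewrite !inE eq_sym e12.
rewrite finset.setDDl !edge_length_set2 //; lra.
Qed.

Lemma flips_path k s t :
    (2 < N)%N -> uniq s -> size s = N -> flips I k s t ->
  exists (T : tour N) (Ts : seq (tour N)), [/\ tour_edges T = cycle_edges s,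
    path (state_graph I) T Ts & size Ts = k].
Proof.
move=> N2 us szs st; elim: st us szs => [{}s|{}k {}s {}t r st _ IH] us szs.
  by exists (Tour (is_tour_cycle_edges N2 us szs)), [::].
have pst := improving_flip_perm st.
have [||T [Ts [TE TTs <-]]] := IH;
  rewrite -?(perm_uniq pst) -?(perm_size pst) //.
exists (Tour (is_tour_cycle_edges N2 us szs)), (T :: Ts); split => //=.
by rewrite TTs andbT; apply: improving_flip_state_graph st.
Qed.

(** A long path is cut down to its first [l] arcs. No tour repeats, because the length strictly
    decreases. *)
Lemma flips_has_path k l s t :
    (2 < N)%N -> uniq s -> size s = N -> flips I k s t -> (l <= k)%N ->
  has_path_of_length I l.
Proof.
move=> N2 us szs st le_lk.
have [T [Ts [_ TTs szTs]]] := flips_path N2 us szs st.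
exists T, (take l Ts); split; rewrite ?size_takel ?szTs ?take_path //.
pose shorter : rel (tour N) := [rel T T' | tour_length I T' < tour_length I T].
apply: (@sorted_uniq _ shorter).
  by move=> T2 T1 T3 lt12 lt23; exact: lt_trans lt23 lt12.
  by move=> T0; rewrite /shorter /= ltxx.
rewrite /sorted; apply: sub_path (take_path _ TTs).
by move=> T1 T2 /asboolP [].
Qed.

End TourLength.

(** * Comparison of the L_p distance with the maximum and Euclidean distances *)

Section LpPlane.
Variable R : realType.
Implicit Types (x y a b U : R) (p : lp_exponent).

Definition plane_point x y : 'rV[R]_2 := \row_j (if j == ord0 then x else y).

Lemma lp_dist_ge0 p (u v : 'rV[R]_2) : 0 <= lp_dist p u v.
Proof.
case: p => [q q_gt0|] /=; first exact: powR_ge0.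
by apply: (big_ind (fun z => 0 <= z)) => // z w z0 w0; rewrite le_max z0.
Qed.

Lemma root_exprn q a : (0 < q)%N -> 0 <= a -> (a ^+ q) `^ q%:R^-1 = a.
Proof.
move=> q0 a0; rewrite -powR_mulrn // -powRrM mulfV ?powRr1 //.
by rewrite pnatr_eq0 -lt0n.
Qed.

(** Both [a] and [b] are at most [U], so the left side is at most
    [U ^+ (q - 2) * (a ^+ 2 + b ^+ 2)]. *)
Lemma exprD_le_euclid q a b U : (1 < q)%N -> 0 <= a -> 0 <= b -> 0 <= U ->
  a ^+ 2 + b ^+ 2 <= U ^+ 2 -> a ^+ q + b ^+ q <= U ^+ q.
Proof.
case: q => [|[|q]] // _ a0 b0 U0 abU.
have aU : a <= U by nra.
have bU : b <= U by nra.
rewrite -[q.+2]addn2 !exprD.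
have aq : a ^+ q <= U ^+ q by apply: lerXn2r.
have bq : b ^+ q <= U ^+ q by apply: lerXn2r.
apply: (@le_trans _ _ (U ^+ q * (a ^+ 2 + b ^+ 2))).
  by rewrite mulrDr lerD // ler_wpM2r // sqr_ge0.
by rewrite ler_wpM2l // exprn_ge0.
Qed.

(* For p = 1 the plane is turned by 45 degrees, which makes the distance twice
   the maximum distance; every other p works in the standard position. *)
Lemma lp_plane_between_max_euclid p :
  exists (f : R -> R -> 'rV[R]_2) (c : R), 0 < c /\
  forall x y x' y', let a := `|x - x'| in let b := `|y - y'| in
    [/\ c * a <= lp_dist p (f x y) (f x' y'),
        c * b <= lp_dist p (f x y) (f x' y') &
        forall U, 0 <= U -> a ^+ 2 + b ^+ 2 <= U ^+ 2 ->
          lp_dist p (f x y) (f x' y') <= c * U].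
Proof.
have norm_max (z w : R) : `|z + w| + `|z - w| = 2 * Num.max `|z| `|w|.
  wlog le_wz : z w / `|w| <= `|z| => [hwlog|].
    have /orP[] := le_total `|w| `|z|; first exact: hwlog.
    by rewrite (addrC z) (distrC z) maxC; exact: hwlog.
  rewrite (max_idPl le_wz); case: (ger0P z) le_wz => z0.
    rewrite ler_norml => /andP[? ?].
    by rewrite !ger0_norm; lra.
  rewrite ler_norml => /andP[? ?].
  by rewrite !ler0_norm; lra.
have maxU a b U : 0 <= a -> 0 <= b -> 0 <= U -> a ^+ 2 + b ^+ 2 <= U ^+ 2 ->
    Num.max a b <= U.
  by move=> a0 b0 U0 abU; rewrite ge_max; apply/andP; split; nra.
case: p => [q q_gt0|].
  have [q_le1|q_gt1] := leqP q 1; last first.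
    exists plane_point, 1; split=> // x y x' y' a b.
    rewrite /= !big_ord_recl big_ord0 !mxE /= addr0 !mul1r -/a -/b.
    have [a0 b0] : 0 <= a /\ 0 <= b by rewrite !normr_ge0.
    have [aq bq] : 0 <= a ^+ q /\ 0 <= b ^+ q by rewrite !exprn_ge0.
    have q1 : 0 <= (q%:R : R)^-1 by rewrite invr_ge0 ler0n.
    split=> [||U U0 abU]; rewrite ?mul1r.
    - rewrite -{1}(root_exprn q_gt0 a0); apply: ge0_ler_powR => //.
      + by rewrite nnegrE addr_ge0.
      + by rewrite lerDl.
    - rewrite -{1}(root_exprn q_gt0 b0); apply: ge0_ler_powR => //.
      + by rewrite nnegrE addr_ge0.
      + by rewrite lerDr.
    - rewrite -(root_exprn q_gt0 U0); apply: ge0_ler_powR => //.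
      + by rewrite nnegrE addr_ge0.
      + by rewrite nnegrE exprn_ge0.
      + exact: exprD_le_euclid.
  case: q q_gt0 q_le1 => [|[|q]] // q_gt0 _.
  exists (fun x y => plane_point (x + y) (x - y)), 2; split=> // x y x' y' a b.
  have dE : lp_dist (LpFin q_gt0) (plane_point (x + y) (x - y))
      (plane_point (x' + y') (x' - y')) = 2 * Num.max a b.
    rewrite /= !big_ord_recl big_ord0 !mxE /= addr0 !expr1 invr1 powRr1.
      have -> : x + y - (x' + y') = (x - x') + (y - y') by ring.
      have -> : x - y - (x' - y') = (x - x') - (y - y') by ring.
      exact: norm_max.
    by rewrite addr_ge0.
  rewrite dE !ler_pM2l // !le_max !lexx orbT; split=> // U U0 abU.
  by rewrite ler_pM2l // maxU // normr_ge0.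
exists plane_point, 1; split=> // x y x' y' a b.
rewrite /= !big_ord_recl big_ord0 !mxE /= !mul1r -/a -/b.
have /max_idPl -> : 0 <= b by rewrite normr_ge0.
rewrite !le_max !lexx orbT; split=> // U U0 abU.
by rewrite mul1r maxU // normr_ge0.
Qed.

End LpPlane.

(** * Coordinates of the gadgets *)

(* The points A, B, C, D of the first block, then those of the second one, which
   is the first one moved by (-1, 0). *)
Definition gadget : seq (int * int) :=
  [:: (3, 0); (- 2, 0); (1, - 6); (0, 10);
      (2, 0); (- 3, 0); (0, - 6); (- 1, 10)]%R.

(* Vertex 8 i + j is point j of gadget i, and the gadgets shrink by 16. *)
Definition site (m k : nat) : int * int :=
  let z := nth (0, 0) gadget (k %% 8) in
  (z.1 *+ 16 ^ (m - k %/ 8), z.2 *+ 16 ^ (m - k %/ 8)).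

(** Up to scaling, gadgets [i] and [i + 1] always look like the 16 points [site 1 o], so each move
    needs checking only once. *)
Lemma site_frame m i o : (i < m)%N -> (o < 16)%N ->
  site m (8 * i + o) =
  ((site 1 o).1 *+ 16 ^ (m - i.+1), (site 1 o).2 *+ 16 ^ (m - i.+1)).
Proof.
move=> lt_im lt_o; rewrite /site mulnC modnMDl divnMDl // -!mulrnA -!expnD.
by have -> : (m - (i + o %/ 8) = 1 - o %/ 8 + (m - i.+1))%N by lia.
Qed.

(** No point of [gadget] has both coordinates divisible by 16, so a position determines its power of
    16, hence its gadget. *)
Lemma site_inj m k l : (k < 8 * m)%N -> (l < 8 * m)%N ->
  site m k = site m l -> k = l.
Proof.
wlog le_kl : k l / (k %/ 8 <= l %/ 8)%N => [hwlog|] lt_k lt_l.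
  by case/orP: (leq_total (k %/ 8) (l %/ 8)) => le_kl; [|move/esym];
    move/hwlog => ->.
rewrite /site; set z := nth _ _ (k %% 8); set w := nth _ _ (l %% 8).
have [e eE] : {e | l %/ 8 = k %/ 8 + e}%N by exists (l %/ 8 - k %/ 8)%N; lia.
have -> : (m - k %/ 8 = e + (m - l %/ 8))%N by lia.
have wgt0 : (0 < 16 ^ (m - l %/ 8))%N by rewrite expn_gt0.
rewrite expnD !mulrnA => -[/(pmulrnI wgt0) ze1 /(pmulrnI wgt0) ze2].
have w_in : w \in gadget by rewrite mem_nth // ltn_mod.
have e0 : e = 0%N.
  have ndvd : all (fun v : int * int =>
      ~~ ((16 %| `|v.1|) && (16 %| `|v.2|))%N) gadget by vm_compute.
  have := allP ndvd _ w_in; case: e {eE} ze1 ze2 => // e <- <-.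
  have d16 (x : int) : (16 %| `|(x *+ 16 ^ e.+1)%R|)%N.
    rewrite -mulr_natr abszM natz absz_nat; apply: dvdn_mull.
    by rewrite expnS; apply: dvdn_mulr.
  by rewrite !d16.
move: ze1 ze2; rewrite e0 expn0 !mulr1n => ze1 ze2.
have : z == w by rewrite -pair_eqE /pair_eq /= ze1 ze2 !eqxx.
rewrite nth_uniq ?ltn_mod // => /eqP eq_mod.
have eq_div : (k %/ 8 = l %/ 8)%N by rewrite eE e0 addn0.
by rewrite (divn_eq k 8) (divn_eq l 8) eq_mod eq_div.
Qed.

(** * Integer distance estimates and certified moves *)

Definition max_gap (z w : int * int) : nat :=
  maxn `|(z.1 - w.1)%R| `|(z.2 - w.2)%R|.
Definition min_gap (z w : int * int) : nat :=
  minn `|(z.1 - w.1)%R| `|(z.2 - w.2)%R|.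

(* First-order bound on the Euclidean distance, rounded up. *)
Definition euclid_bound (z w : int * int) : nat :=
  max_gap z w + (min_gap z w ^ 2 %/ (2 * max_gap z w)).+1.

(** If [a >= b], [a > 0] and [e > b ^ 2 / (2 a)], then [(a + e) ^ 2 >= a ^ 2 + 2 a e >= a ^ 2 + b ^
    2]. *)
Lemma euclid_boundP z w :
  (`|(z.1 - w.1)%R| ^ 2 + `|(z.2 - w.2)%R| ^ 2 <= euclid_bound z w ^ 2)%N.
Proof.
rewrite /euclid_bound /max_gap /min_gap.
move: `|(z.1 - w.1)%R|%N `|(z.2 - w.2)%R|%N => a b.
wlog le_ba : a b / (b <= a)%N => [hwlog|].
  by case/orP: (leq_total a b) => /hwlog //; rewrite addnC maxnC minnC.
rewrite (maxn_idPl le_ba) (minn_idPr le_ba); have [a0|a_gt0] := posnP a.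
  by move: le_ba; rewrite a0 leqn0 => /eqP ->.
have /ltn_ceil - /(_ (b ^ 2)%N) : (0 < 2 * a)%N by lia.
by set e := (_.+1) => lt_be; nia.
Qed.

(** A computable sufficient test, valid for all exponents at once and at every scale. *)
Definition improves (u1 u2 v1 v2 : nat) : bool :=
  all (gtn 16) [:: u1; u2; v1; v2] &&
  (euclid_bound (site 1 u1) (site 1 v1) + euclid_bound (site 1 u2) (site 1 v2)
     < max_gap (site 1 u1) (site 1 u2) + max_gap (site 1 v1) (site 1 v2))%N.

(* The move (a, k) reverses the k + 2 entries that follow position a. *)
Definition apply_move (t : seq nat) (ak : nat * nat) : option (seq nat) :=
  if drop ak.1 t is u1 :: u2 :: t1 then
    if drop ak.2 t1 is v1 :: v2 :: r then
      if improves u1 u2 v1 v2 then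
        Some (take ak.1 t ++ u1 :: v1 :: rev (take ak.2 t1) ++ u2 :: v2 :: r)
      else None
    else None
  else None.

Fixpoint apply_moves (t : seq nat) (ms : seq (nat * nat)) : option (seq nat) :=
  if ms is ak :: ms' then
    if apply_move t ak is Some t' then apply_moves t' ms' else None
  else Some t.

(* Entries 0-3 and 4-7 are the two blocks of a gadget, so that 0 1 2 3 is the
   long path A B C D and 0 2 1 3 the short path A C B D. *)
Definition long_long := [:: 0; 1; 2; 3; 4; 5; 6; 7]%N.
Definition short_long := [:: 0; 2; 1; 3; 4; 5; 6; 7]%N.
Definition short_short := [:: 0; 2; 1; 3; 4; 6; 5; 7]%N.

(* Found by a computer search, as were the coordinates of [gadget]. *)
Lemma discharge_first_block :
  apply_moves (long_long ++ map (addn 8) short_short)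
    [:: (0, 10); (0, 0); (2, 6); (8, 0); (2, 10); (0, 4); (2, 10)]%N
  = Some (short_long ++ map (addn 8) long_long).
Proof. by vm_compute. Qed.

Lemma discharge_second_block :
  apply_moves (short_long ++ map (addn 8) short_short)
    [:: (4, 6); (4, 0); (6, 2); (8, 0); (6, 6); (4, 4); (6, 6)]%N
  = Some (short_short ++ map (addn 8) long_long).
Proof. by vm_compute. Qed.

(** With no further gadget to reset, one move per block is enough. *)
Lemma discharge_last_gadget :
  apply_moves long_long [:: (0, 0); (4, 0)]%N = Some short_short.
Proof. by vm_compute. Qed.

(** * Layout of the whole tour and number of steps *)

Definition place (i : nat) : seq nat -> seq nat := map (addn (8 * i)).

Fixpoint short_tail (i k : nat) : seq nat :=
  if k is k'.+1 then place i short_short ++ short_tail i.+1 k' else [::].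

Lemma place_cat i t t' : place i (t ++ t') = place i t ++ place i t'.
Proof. exact: map_cat. Qed.

Lemma place_next i t : place i (map (addn 8) t) = place i.+1 t.
Proof. by rewrite /place -map_comp; apply: eq_map => j /=; lia. Qed.

Lemma perm_place i t : perm_eq t (iota 0 8) ->
  perm_eq (place i t) (iota (8 * i) 8).
Proof. by move/(perm_map (addn (8 * i))); rewrite -iotaDl addn0. Qed.

Lemma perm_tour i k t : perm_eq t (iota 0 8) ->
  perm_eq (place i t ++ short_tail i.+1 k) (iota (8 * i) (8 * k.+1)).
Proof.
elim: k i t => [|k IH] i t pt.
  by rewrite cats0 perm_place.
rewrite [X in iota _ X]mulnS iotaD perm_cat ?perm_place //.
by rewrite [X in iota X]addnC -mulnS; apply: IH.
Qed.

Fixpoint counter_length (k : nat) : nat :=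
  if k is k'.+1 then (14 + 2 * counter_length k')%N else 2.

Lemma counter_lengthE k : (counter_length k + 14 = 2 ^ (k + 4))%N.
Proof. by elim: k => [|k IH] //=; rewrite addSn expnS -IH; lia. Qed.

(** * The counter realised in the L_p plane *)

Section Counter.
Variables (R : realType) (p : lp_exponent) (m : nat).
Variables (f : R -> R -> 'rV[R]_2) (c : R).
Hypothesis c_gt0 : 0 < c.
Hypothesis f_between : forall x y x' y',
  let a := `|x - x'| in let b := `|y - y'| in
  [/\ c * a <= lp_dist p (f x y) (f x' y'),
      c * b <= lp_dist p (f x y) (f x' y') &
      forall U, 0 <= U -> a ^+ 2 + b ^+ 2 <= U ^+ 2 ->
        lp_dist p (f x y) (f x' y') <= c * U].

Definition site_point (k : nat) : 'rV[R]_2 :=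
  f (site m k).1%:~R (site m k).2%:~R.

Definition site_dist (k l : nat) : R := lp_dist p (site_point k) (site_point l).

Lemma site_point_inj k l : (k < 8 * m)%N -> (l < 8 * m)%N ->
  site_point k = site_point l -> k = l.
Proof.
move=> lt_k lt_l; rewrite /site_point.
have f_inj x y x' y' : f x y = f x' y' -> x = x' /\ y = y'.
  move=> eq_f; have := f_between x y x' y'; rewrite /= -eq_f => -[ax by_ _].
  (* The bound [U = 0] shows that a point has distance at most 0 from itself; the lower bounds then
     separate distinct points. *)
  have [_ _ /(_ 0)] := f_between x y x y.
  rewrite !subrr normr0 mulr0 expr0n addr0 => /(_ (lexx _) (lexx _)) d0.
  have := le_trans ax d0; have := le_trans by_ d0.
  rewrite !pmulr_rle0 // !normr_le0 !subr_eq0 => /eqP -> /eqP ->; by [].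
case/f_inj=> /intr_inj e1 /intr_inj e2; apply: (@site_inj m) => //.
by rewrite [LHS]surjective_pairing e1 e2 -surjective_pairing.
Qed.

Definition scale (i : nat) : R := c * (16 ^ (m - i.+1))%:R.

(** The common factor [scale i] on both sides lets integer comparisons decide the real ones. *)
Lemma site_dist_bounds i o o' : (i < m)%N -> (o < 16)%N -> (o' < 16)%N ->
  scale i * (max_gap (site 1 o) (site 1 o'))%:R
    <= site_dist (8 * i + o) (8 * i + o')
    <= scale i * (euclid_bound (site 1 o) (site 1 o'))%:R.
Proof.
move=> lt_im lt_o lt_o'; rewrite /site_dist /site_point /scale !site_frame //.
move: (site 1 o) (site 1 o') (16 ^ (m - i.+1))%N => z w q /=.
have gapE (x y : int) :
    `|(x *+ q)%:~R - (y *+ q)%:~R| = (q * `|(x - y)%R|)%:R :> R.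
  rewrite -intrB -mulrnBl -(mulr_natr (x - y)) natz intrM normrM natrM.
  by rewrite natr_absz intr_norm mulrC -pmulrn normr_nat.
have := f_between (z.1 *+ q)%:~R (z.2 *+ q)%:~R (w.1 *+ q)%:~R (w.2 *+ q)%:~R.
rewrite /= !gapE => -[le1 le2 leU].
apply/andP; split.
  rewrite -mulrA -natrM /max_gap.
  case/orP: (leq_total `|(z.1 - w.1)%R| `|(z.2 - w.2)%R|) => le_gap.
    by rewrite (maxn_idPr le_gap).
  by rewrite (maxn_idPl le_gap).
rewrite -mulrA -natrM; apply: leU => //.
rewrite -!natrX -natrD ler_nat !expnMn -mulnDr leq_mul2l.
by rewrite euclid_boundP orbT.
Qed.

Lemma apply_move_flip i t t' ak pre suf : (i < m)%N ->
  apply_move t ak = Some t' ->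
  improving_flip site_dist (pre ++ place i t ++ suf) (pre ++ place i t' ++ suf).
Proof.
move=> lt_im; rewrite /apply_move.
case E : (drop ak.1 t) => [|u1 [|u2 t1]] //.
case E1 : (drop ak.2 t1) => [|v1 [|v2 r]] //.
case: ifP => // /andP [/and5P [lt1 lt2 lt3 lt4 _] gain] [<-].
rewrite -{1}(cat_take_drop ak.1 t) E -{1}(cat_take_drop ak.2 t1) E1.
rewrite /place !map_cat /= !map_cat map_rev /= -!catA /= -!catA /=.
rewrite !(catA pre); apply: ImprovingFlip.
have scale_gt0 : 0 < scale i by rewrite mulr_gt0 // ltr0n expn_gt0.
have /andP[_ U1] := site_dist_bounds lt_im lt1 lt3.
have /andP[_ U2] := site_dist_bounds lt_im lt2 lt4.
have /andP[L1 _] := site_dist_bounds lt_im lt1 lt2.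
have /andP[L2 _] := site_dist_bounds lt_im lt3 lt4.
apply: le_lt_trans (lerD U1 U2) (lt_le_trans _ (lerD L1 L2)).
by rewrite -!mulrDr -!natrD ltr_pM2l // ltr_nat.
Qed.

Lemma apply_moves_flips i t t' ms pre suf : (i < m)%N ->
  apply_moves t ms = Some t' ->
  flips site_dist (size ms)
    (pre ++ place i t ++ suf) (pre ++ place i t' ++ suf).
Proof.
move=> lt_im; elim: ms t => [|ak ms IH] t /=; first by case=> <-; exact: Flips0.
case E : apply_move => [t1|] // /IH; apply: FlipsS.
exact: apply_move_flip E.
Qed.

Lemma counter_flips k i pre : (i + k.+1 = m)%N ->
  flips site_dist (counter_length k)
    (pre ++ place i long_long ++ short_tail i.+1 k)
    (pre ++ place i short_short ++ short_tail i.+1 k).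
Proof.
elim: k i pre => [|k IH] i pre im.
  by apply: (apply_moves_flips _ _ _ discharge_last_gadget); lia.
have lt_im : (i < m)%N by lia.
(* Two adjacent gadgets are merged into one window of 16 labels, in which the discharge moves
   act. *)
have split_place t t' :
    pre ++ place i t ++ place i.+1 t' ++ short_tail i.+2 k =
    pre ++ place i (t ++ map (addn 8) t') ++ short_tail i.+2 k.
  by rewrite place_cat place_next -catA.
have -> : counter_length k.+1 =
    (7 + (counter_length k + (7 + counter_length k)))%N by move=> /=; lia.
have -> : short_tail i.+1 k.+1 =
    place i.+1 short_short ++ short_tail i.+2 k by [].
rewrite !split_place.
apply: flips_trans (apply_moves_flips _ _ lt_im discharge_first_block) _.
rewrite -split_place !(catA pre).
apply: flips_trans (IH i.+1 _ _) _; first by lia.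
rewrite -!catA !split_place.
apply: flips_trans (apply_moves_flips _ _ lt_im discharge_second_block) _.
by rewrite -!split_place !(catA pre); apply: IH; lia.
Qed.

End Counter.

Theorem theorem1 (R : realType) (p : lp_exponent) (n : nat) (hn : (0 < n)%N) :
  exists P : 'I_(16 * n) -> 'rV[R]_2,
    injective P /\
    has_path_of_length (lp_instance p P) (2 ^ (n + 4) - 22).
Proof.
have [f [c [c_gt0 f_between]]] := lp_plane_between_max_euclid R p.
pose m := (2 * n)%N; have Nm : (16 * n = 8 * m)%N by rewrite /m; lia.
pose P (k : 'I_(16 * n)) : 'rV[R]_2 := site_point m f k.
exists P; split.
  move=> k l; rewrite /P => /(site_point_inj c_gt0 f_between) eq_kl.
  by apply/val_inj/eq_kl; rewrite -Nm.
have N_gt0 : (0 < 16 * n)%N by lia.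
(* Labels outside the range are sent to vertex 0; those in [s0] are all in range. *)
pose vertex (k : nat) : 'I_(16 * n) := insubd (Ordinal N_gt0) k.
have vertexK k : (k < 16 * n)%N -> vertex k = k :> nat.
  by move=> lt_k; rewrite val_insubd lt_k.
pose s0 := place 0 long_long ++ short_tail 1 m.-1.
have s0_perm : perm_eq s0 (iota 0 (16 * n)).
  by rewrite Nm (_ : m = m.-1.+1) ?perm_tour // prednK // /m; lia.
have s0_lt k : k \in s0 -> (k < 16 * n)%N.
  by rewrite (perm_mem s0_perm) mem_iota.
have s0_dist : {in s0 &, forall k l,
    lp_instance p P (vertex k) (vertex l) = site_dist p m f k l}.
  by move=> k l ks ls; rewrite /site_dist /= /P !vertexK ?s0_lt.
have m_pred : (0 + m.-1.+1 = m)%N by rewrite /m; lia.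
have s0_flips := counter_flips c_gt0 f_between [::] m_pred.
apply: (flips_has_path _ _ _ _ (flips_map s0_dist s0_flips)).
- by move=> u v; apply: lp_dist_ge0.
- by lia.
- rewrite map_inj_in_uniq ?(perm_uniq s0_perm) ?iota_uniq // => k l ks ls eq_kl.
  by rewrite -(vertexK k) ?s0_lt // eq_kl vertexK ?s0_lt.
- by rewrite size_map (perm_size s0_perm) size_iota.
(* As [m.-1 = 2 n - 1 >= n], the run of [2 ^ (2 n + 3) - 14] flips is long enough to be
   truncated. *)
have := counter_lengthE m.-1.
have : (2 ^ (n + 4) <= 2 ^ (m.-1 + 4))%N by rewrite leq_exp2l // /m; lia.
by lia.
Qed.
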